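(* Let $t_n(321)$ be the number of permutations $\pi\in\mathcal{S}_n$ such that both $\pi$ and $\theta(\pi)$ avoid $321$. Then $$\sum_{n\geq 1} t_n(321)x^n = \frac{2x^2}{2x(1-x)-1+\sqrt{1-4x^2}}.$$
   Context: $\mathcal{S}_n$ is the symmetric group on $[n]$, permutations in one-line notation $\pi_1\cdots\pi_n$. A permutation avoids a pattern $\tau$ if it has no subsequence order-isomorphic to $\tau$. The standard cycle notation of $\pi$ writes each cycle (fixed points included) with its largest element first and orders cycles by increasing largest element. The fundamental bijection $\theta:\mathcal{S}_n\to\mathcal{S}_n$ maps $\pi$ to the permutation whose one-line notation is obtained by erasing the parentheses of the standard cycle notation of $\pi$. *)

(* Defs.v *)
From HB Require Import structures.
From mathcomp Require Import all_boot all_order all_fingroup all_algebra.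
From mathcomp Require Import fraction boolp.

Set Implicit Arguments.
Unset Strict Implicit.
Unset Printing Implicit Defensive.

Import GRing.Theory.
Local Open Scope ring_scope.

(** * Formal power series over a field *)

(* A record rather than an alias of [nat -> K], whose canonical ring structure
   in MathComp-Analysis is pointwise. *)
Record fps (K : fieldType) := Fps { coefs : nat -> K }.

Section FormalPowerSeries.
Variable K : fieldType.
Implicit Types f g h : fps K.

Lemma fpsP f g : coefs f =1 coefs g -> f = g.
Proof. by case: f g => [f] [g] /= /funext ->. Qed.

HB.instance Definition _ := gen_eqMixin (fps K).
HB.instance Definition _ := gen_choiceMixin (fps K).

Definition fps0 : fps K := Fps (fun=> 0).
Definition fps_opp f : fps K := Fps (fun n => - coefs f n).
Definition fps_add f g : fps K := Fps (fun n => coefs f n + coefs g n).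

Fact fps_addA : associative fps_add.
Proof. by move=> f g h; apply: fpsP => n /=; rewrite addrA. Qed.
Fact fps_addC : commutative fps_add.
Proof. by move=> f g; apply: fpsP => n /=; rewrite addrC. Qed.
Fact fps_add0 : left_id fps0 fps_add.
Proof. by move=> f; apply: fpsP => n /=; rewrite add0r. Qed.
Fact fps_addN : left_inverse fps0 fps_opp fps_add.
Proof. by move=> f; apply: fpsP => n /=; rewrite addNr. Qed.

HB.instance Definition _ :=
  GRing.isZmodule.Build (fps K) fps_addA fps_addC fps_add0 fps_addN.

Definition fps1 : fps K := Fps (fun n => (n == 0)%:R).
Definition fps_mul f g : fps K :=
  Fps (fun n => \sum_(i < n.+1) coefs f i * coefs g (n - i)).

Definition fps_trunc m f : {poly K} := \poly_(i < m.+1) coefs f i.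

Lemma coef_fps_trunc m f i : (i <= m)%N -> (fps_trunc m f)`_i = coefs f i.
Proof. by move=> le_im; rewrite coef_poly ltnS le_im. Qed.

Lemma coefs_mul_trunc m n f g : (n <= m)%N ->
  coefs (fps_mul f g) n = (fps_trunc m f * fps_trunc m g)`_n.
Proof.
move=> le_nm; rewrite coefM; apply: eq_bigr => i _.
rewrite !coef_fps_trunc //; first exact: leq_trans (leq_subr _ _) le_nm.
by apply: leq_trans le_nm; rewrite -ltnS.
Qed.

Fact fps_mulC : commutative fps_mul.
Proof. by move=> f g; apply: fpsP => n; rewrite !(@coefs_mul_trunc n) // mulrC. Qed.

Fact fps_mulA : associative fps_mul.
Proof.
move=> f g h; apply: fpsP => n.
pose t := fps_trunc n.
transitivity ((t f * (t g * t h))`_n).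
  rewrite coefM; apply: eq_bigr => i _.
  by rewrite coef_fps_trunc -1?ltnS // (@coefs_mul_trunc n) ?leq_subr.
rewrite mulrA coefM; apply: eq_bigr => i _.
by rewrite coef_fps_trunc ?leq_subr // -(@coefs_mul_trunc n) // -ltnS.
Qed.

Fact fps_mul1 : left_id fps1 fps_mul.
Proof.
move=> f; apply: fpsP => n /=.
rewrite big_ord_recl /= mul1r subn0 big1 ?addr0 // => i _.
by rewrite mul0r.
Qed.

Fact fps_mulDl : left_distributive fps_mul fps_add.
Proof.
move=> f g h; apply: fpsP => n /=.
by rewrite -big_split; apply: eq_bigr => i _ /=; rewrite mulrDl.
Qed.

Fact fps1_neq0 : fps1 != 0.
Proof. by apply/eqP => /(congr1 (fun f => coefs f 0%N)) /eqP; rewrite oner_eq0. Qed.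

HB.instance Definition _ := GRing.Zmodule_isComNzRing.Build (fps K)
  fps_mulA fps_mulC fps_mul1 fps_mulDl fps1_neq0.

Lemma coefs0 n : coefs (0 : fps K) n = 0. Proof. by []. Qed.
Lemma coefs1 n : coefs (1 : fps K) n = (n == 0)%:R. Proof. by []. Qed.
Lemma coefsN f n : coefs (- f) n = - coefs f n. Proof. by []. Qed.
Lemma coefsD f g n : coefs (f + g) n = coefs f n + coefs g n. Proof. by []. Qed.
Lemma coefsM f g n :
  coefs (f * g) n = \sum_(i < n.+1) coefs f i * coefs g (n - i).
Proof. by []. Qed.

(* The sequence u with u n = step [:: u 0; ...; u n.-1]. *)
Section CourseOfValues.
Variable step : seq K -> K.

Fixpoint cov_prefix n : seq K :=
  if n is m.+1 then rcons (cov_prefix m) (step (cov_prefix m)) else [::].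

Definition cov_fps : fps K := Fps (fun n => step (cov_prefix n)).

Lemma size_cov_prefix n : size (cov_prefix n) = n.
Proof. by elim: n => //= n IHn; rewrite size_rcons IHn. Qed.

Lemma nth_cov_prefix n i : (i < n)%N -> (cov_prefix n)`_i = coefs cov_fps i.
Proof.
elim: n => //= n IHn; rewrite nth_rcons size_cov_prefix ltnS leq_eqVlt.
by case/predU1P => [->|lt_in]; [rewrite ltnn eqxx | rewrite lt_in IHn].
Qed.

End CourseOfValues.

Definition fps_unit : pred (fps K) := fun f => coefs f 0 != 0.

Definition fps_inv f : fps K :=
  if fps_unit f then
    cov_fps (fun s => (coefs f 0)^-1 *
      ((size s == 0)%:R - \sum_(i < size s) s`_i * coefs f (size s - i)))
  else f.

Fact fps_mulV : {in fps_unit, left_inverse 1 fps_inv *%R}.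
Proof.
move=> f; rewrite -topredE /= => uf; apply: fpsP => n.
rewrite coefsM big_ord_recr /= subnn /fps_inv uf /= size_cov_prefix.
rewrite mulrAC mulVf // mul1r addrC -[RHS]addr0 -addrA; congr (_ + _).
apply/eqP; rewrite addrC subr_eq0; apply/eqP.
by apply: eq_bigr => i _; rewrite nth_cov_prefix.
Qed.

Fact fps_unitPl f g : g * f = 1 -> fps_unit f.
Proof.
move/(congr1 (fun h => coefs h 0%N)); rewrite coefsM big_ord1 /=.
by rewrite /fps_unit => eq1; apply: contra_eq_neq eq1 => ->; rewrite mulr0 eq_sym oner_eq0.
Qed.

Fact fps_inv_out : {in [predC fps_unit], fps_inv =1 id}.
Proof. by move=> f; rewrite inE -topredE /= /fps_inv => /negbTE ->. Qed.

HB.instance Definition _ := GRing.ComNzRing_hasMulInverse.Build (fps K)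
  fps_mulV fps_unitPl fps_inv_out.

Lemma fps_neq0_lead f : f != 0 ->
  exists2 i, coefs f i != 0 & forall j, (j < i)%N -> coefs f j = 0.
Proof.
move=> nz_f; have ex_i : exists i, coefs f i != 0.
  apply/not_existsP => z_f; case/eqP: nz_f; apply: fpsP => i.
  by apply/eqP; rewrite -[_ == _]negbK; apply/negP/z_f.
case: (ex_minnP ex_i) => i nz_fi min_i; exists i => // j lt_ji.
by apply/eqP; apply: contraLR lt_ji => /min_i; rewrite -leqNgt.
Qed.

Fact fps_integral f g : f * g = 0 -> (f == 0) || (g == 0).
Proof.
move=> fg0; apply/norP => -[/fps_neq0_lead[i nz_fi lt_i] /fps_neq0_lead[j nz_gj lt_j]].
have /eqP : coefs (f * g) (i + j) = 0 by rewrite fg0.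
have lt_iij : (i < (i + j).+1)%N by rewrite ltnS leq_addr.
rewrite coefsM (bigD1 (Ordinal lt_iij)) //= addKn big1 => [|k].
  by rewrite addr0 mulf_eq0 (negbTE nz_fi) (negbTE nz_gj).
rewrite -val_eqE /= neq_ltn => /orP[/lt_i -> | lt_ik]; first by rewrite mul0r.
by rewrite (lt_j (_ - _)%N) ?mulr0 // ltn_subLR ?ltn_add2r // -ltnS.
Qed.

HB.instance Definition _ :=
  GRing.ComUnitRing_isIntegral.Build (fps K) fps_integral.

Definition fpsX : fps K := Fps (fun n => (n == 1)%:R).

(* The square root with constant term 1 of a series with constant term 1:
   2 s_n = f_n - \sum_(0 < i < n) s_i s_(n - i) for n > 0. *)
Definition fps_sqrt f : fps K :=
  cov_fps (fun s => if s is [::] then 1 else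
    2^-1 * (coefs f (size s) - \sum_(1 <= i < size s) s`_i * s`_(size s - i))).

Lemma coefs_sqrt0 f : coefs (fps_sqrt f) 0 = 1.
Proof. by []. Qed.

Lemma fps_sqrtK f : 2 != 0 :> K -> coefs f 0 = 1 -> fps_sqrt f ^+ 2 = f.
Proof.
move=> nz2 f0; set s := fps_sqrt f.
have s0 : coefs s 0 = 1 by [].
have sS n : coefs s n.+1 =
    2^-1 * (coefs f n.+1 - \sum_(i < n) coefs s i.+1 * coefs s (n - i)).
  rewrite {1}/s /fps_sqrt /cov_fps /=.
  set p := rcons _ _.
  have p_nth i : (i < n.+1)%N -> p`_i = coefs s i by exact: nth_cov_prefix.
  have sz_p : size p = n.+1 by exact: (size_cov_prefix _ n.+1).
  have -> (x y : K) : (if p is [::] then x else y) = y by case: p sz_p {p_nth}.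
  rewrite sz_p big_add1 /= big_mkord; congr (_ * (_ - _)).
  by apply: eq_bigr => i _; rewrite !p_nth ?subSS ?ltnS ?leq_subr.
clearbody s; apply: fpsP => -[|n].
  by rewrite expr2 coefsM big_ord1 s0 mulr1 f0.
rewrite expr2 coefsM big_ord_recr big_ord_recl /= subnn subn0 s0 mul1r mulr1.
rewrite addrAC -mulr2n -mulr_natl sS mulrA mulfV // mul1r.
by under [X in _ + X]eq_bigr do rewrite subSS; rewrite subrK.
Qed.

Lemma fps_sqrt_uniq f g : 2 != 0 :> K -> coefs g 0 = 1 -> g ^+ 2 = f ->
  fps_sqrt f = g.
Proof.
move=> nz2 g0 def_f; have f0 : coefs f 0 = 1.
  by rewrite -def_f expr2 coefsM big_ord1 g0 mulr1.
have /eqP := fps_sqrtK nz2 f0; rewrite -def_f eqf_sqr def_f.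
case/orP=> /eqP // eq_sN; case/eqP: nz2.
have := coefs_sqrt0 f; rewrite eq_sN coefsN g0 => /eqP.
by rewrite eq_sym -subr_eq0 opprK => /eqP.
Qed.

End FormalPowerSeries.

Arguments fpsX {K}.

Notation "x %:F" := (tofrac x) : ring_scope.

(** * Permutations: pattern avoidance and the fundamental bijection *)

(* [n] is represented by 'I_n = {0, ..., n - 1}. *)

Definition contains k n (tau : 'S_k) (pi : 'S_n) : bool :=
  [exists f : {ffun 'I_k -> 'I_n},
    [forall a : 'I_k, forall b : 'I_k, (a < b)%N ==> (f a < f b)%N] &&
    [forall a : 'I_k, forall b : 'I_k, (pi (f a) < pi (f b))%N == (tau a < tau b)%N]].

Definition avoids k n (tau : 'S_k) (pi : 'S_n) : bool := ~~ contains tau pi.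

(* The decreasing pattern 321, i |-> 2 - i on {0, 1, 2}. *)
Definition pat321 : 'S_3 := perm (@rev_ord_inj 3).

Section FundamentalBijection.
Variable n : nat.
Implicit Types (pi : 'S_n) (m x : 'I_n).

Definition cycle_max pi m : bool := [forall x in porbit pi m, (x <= m)%N].

(* [enum 'I_n] is increasing, and the cycle with largest element m is written
   m, pi m, pi (pi m), ... *)
Definition standard_cycles pi : seq (seq 'I_n) :=
  [seq traject pi m #|porbit pi m| | m <- enum 'I_n & cycle_max pi m].

Definition theta_word pi : seq 'I_n := flatten (standard_cycles pi).

Lemma count_theta_word pi x : count_mem x (theta_word pi) = 1%N.
Proof.
have [m m_x max_m] := arg_maxnP (fun y : 'I_n => y : nat) (porbit_id pi x).
have eq_mx : porbit pi m = porbit pi x.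
  by apply/eqP; rewrite eq_porbit_mem.
rewrite /theta_word count_flatten -map_comp sumnE big_map big_filter /=.
rewrite big_enum_cond /= (bigD1 m) /=; last first.
  by apply/forall_inP => y; rewrite eq_mx => /max_m.
rewrite count_uniq_mem ?uniq_traject_porbit // -porbit_traject eq_mx porbit_id.
rewrite big1 // => k /andP[/forall_inP max_k ne_km].
rewrite count_uniq_mem ?uniq_traject_porbit // -porbit_traject.
case: (boolP (x \in _)) => // k_x; case/eqP: ne_km.
have eq_kx : porbit pi k = porbit pi x by apply/esym/eqP; rewrite eq_porbit_mem.
apply/val_inj/eqP; rewrite eqn_leq max_k ?andbT; last by rewrite eq_kx.
by apply: max_m; have := porbit_id pi k; rewrite eq_kx.
Qed.

Lemma perm_theta_word pi : perm_eq (theta_word pi) (enum 'I_n).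
Proof.
apply/allP => x _ /=; rewrite count_theta_word.
by rewrite count_uniq_mem ?enum_uniq // mem_enum.
Qed.

Lemma size_theta_word pi : size (theta_word pi) = n.
Proof. by rewrite (perm_size (perm_theta_word pi)) size_enum_ord. Qed.

Lemma uniq_theta_word pi : uniq (theta_word pi).
Proof. by rewrite (perm_uniq (perm_theta_word pi)) enum_uniq. Qed.

(* The default value of [nth] is never used, by [size_theta_word]. *)
Definition theta_fun pi (i : 'I_n) : 'I_n := nth i (theta_word pi) i.

Lemma theta_fun_inj pi : injective (theta_fun pi).
Proof.
move=> i j; rewrite /theta_fun (set_nth_default i j) ?size_theta_word // => /eqP.
by rewrite nth_uniq ?size_theta_word ?uniq_theta_word // => /eqP/val_inj.
Qed.

Definition theta pi : 'S_n := perm (@theta_fun_inj pi).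

Lemma theta_one_line pi : [seq theta pi i | i <- enum 'I_n] = theta_word pi.
Proof.
case: (posnP n) => [n0 | n_gt0].
  have /eqP := size_theta_word pi; rewrite [X in _ == X]n0 size_eq0 => /eqP ->.
  by apply/nilP; rewrite /nilp size_map size_enum_ord n0.
pose x0 := Ordinal n_gt0; apply: (@eq_from_nth _ x0).
  by rewrite size_map size_enum_ord size_theta_word.
move=> i; rewrite size_map size_enum_ord => lt_in.
rewrite (nth_map x0) ?size_enum_ord // permE /theta_fun nth_enum_ord //.
by apply: set_nth_default; rewrite size_theta_word.
Qed.

End FundamentalBijection.

(* t_n(tau) *)
Definition tcount k (tau : 'S_k) (n : nat) : nat :=
  #|[set pi : 'S_n | avoids tau pi && avoids tau (theta pi)]|.

(* Main.v *)
Require Import Defs.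
From mathcomp Require Import all_boot all_order all_fingroup all_algebra.
From mathcomp Require Import fraction zify ring.

(* Cycle maxima are the left-to-right maxima of theta(pi), so theta(pi) avoids
   321 iff its other letters increase: every cycle is (m a_1 ... a_k) with
   a_1 < ... < a_k < m, and these runs follow each other increasingly.

   Read i = 1, ..., n and write U if pi(i) > i < pi^-1(i), L if
   pi^-1(i) < i < pi(i), D if both are smaller than i, F if i is fixed.  If pi
   avoids 321, it increases on {U, L} and on {D, F}, hence is determined by its
   word: the k-th letter in {U, L} goes to the k-th one in {L, D}, the k-th
   letter in {D, F} to the k-th one in {U, F}.  The height after i is the
   number of j <= i with pi(j) > i.  Both pi and theta(pi) avoid 321 exactly for
   Motzkin paths whose level steps are F at height 0 and L at height 1.  With
   c = 1 + x^2 c^2, words starting from height h > 0 have generating function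
   (xc)^h / (1 - x - xc), those from height 0 (1 - xc) / (1 - x - xc), and
   2 x^2 c = 1 - sqrt(1 - 4 x^2). *)

Set Implicit Arguments.
Unset Strict Implicit.
Unset Printing Implicit Defensive.

Import GRing.Theory.
Local Open Scope nat_scope.

(** * The order of letters in theta(pi) *)

Section Avoidance.
Variable n : nat.
Implicit Types (pi : 'S_n) (i j k : 'I_n).

Lemma avoids321P pi :
  reflect (forall i j k, i < j -> j < k -> pi k < pi j -> pi j < pi i -> False)
          (avoids pat321 pi).
Proof.
apply: (iffP idP) => [/existsPn no i j k ij jk kj ji | no].
  have /negP := no [ffun a : 'I_3 => nth i [:: i; j; k] a]; apply.
  apply/andP; split; apply/forallP => -[[|[|[|//]]] ?]; apply/forallP;
    move=> -[[|[|[|//]]] ?]; rewrite !ffunE ?permE /=; lia.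
apply/existsPn => f; apply/negP => /andP[/forallP incr /forallP decr].
pose a0 : 'I_3 := inord 0; pose a1 : 'I_3 := inord 1; pose a2 : 'I_3 := inord 2.
have v0 : a0 = 0 :> nat by rewrite inordK.
have v1 : a1 = 1 :> nat by rewrite inordK.
have v2 : a2 = 2 :> nat by rewrite inordK.
have := forallP (incr a0) a1; have := forallP (incr a1) a2.
have := forallP (decr a1) a0; have := forallP (decr a2) a1.
rewrite !permE /= v0 v1 v2 /= !subSS => /eqP p21 /eqP p10 f12 f01.
by apply: (no _ _ _ f01 f12); rewrite ?p21 ?p10.
Qed.

(** Pigeonhole: were no position from [t] on sent below [t], [pi^-1] would map the positions below
    [t] into, hence onto, themselves, so [j] would be the preimage of a value below [t]. *)
Lemma crossing_down pi (t : nat) j : j < t -> t <= pi j ->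
  exists2 k : 'I_n, t <= k & pi k < t.
Proof.
move=> jt tj; apply/exists_inP; apply: contraT => /exists_inPn no.
pose B := [set k : 'I_n | k < t].
have sub : (pi^-1)%g @: B \subset B.
  apply/subsetP => k /imsetP[l]; rewrite !inE => lt ->.
  rewrite ltnNge; apply/negP => /no.
  by rewrite permKV lt.
have /eqP eqB : (pi^-1)%g @: B == B.
  by rewrite eqEcard sub (card_imset _ (@perm_inj _ (pi^-1)%g)) leqnn.
have : j \in B by rewrite inE.
by rewrite -eqB => /imsetP[l]; rewrite inE => lt jl; move: tj; rewrite jl permKV leqNgt lt.
Qed.

Lemma crossing_up pi (t : nat) k : t <= k -> pi k < t ->
  exists2 j : 'I_n, j < t & t <= pi j.
Proof.
move=> tk kt; have [||j tj jt] := @crossing_down (pi^-1)%g t (pi k) => //.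
  by rewrite permK.
by exists ((pi^-1)%g j) => //; rewrite permKV.
Qed.

(** If [pi j < pi i], some [k >= pi j > j] has [pi k < pi j], and [i], [j], [k] form a 321. *)
Lemma avoids321_exc_mono pi i j : avoids pat321 pi ->
  i < j -> j < pi j -> pi i < pi j.
Proof.
move=> /avoids321P av ij jj; rewrite ltnNge; apply/negP => le.
have ne : pi i != pi j :> nat by rewrite val_eqE (inj_eq perm_inj) -val_eqE /=; lia.
have [k jk kj] := crossing_down jj (leqnn _).
by apply: (av i j k); lia.
Qed.

(** If [pi j < pi i], some [p <= pi i <= i] other than [i] has [pi p > pi i], and [p], [i], [j] form
    a 321. *)
Lemma avoids321_nonexc_mono pi i j : avoids pat321 pi ->
  i < j -> pi i <= i -> pi i < pi j.
Proof.
move=> /avoids321P av ij ii; rewrite ltnNge; apply/negP => le.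
have ne : pi i != pi j :> nat by rewrite val_eqE (inj_eq perm_inj) -val_eqE /=; lia.
have [|| p pi1 pi2] := @crossing_up pi (pi i).+1 j; [lia|lia|].
have np : p != i :> nat by apply/eqP => /val_inj E; move: pi2; rewrite E; lia.
by apply: (av p i j); lia.
Qed.

End Avoidance.

(** * Comparing letters by their place in the standard cycle notation *)

Section CycleOrder.
Variables (n : nat) (pi : 'S_n).
Implicit Types x y z m : 'I_n.

Definition cmax x : 'I_n := [arg max_(y > x in porbit pi x) (y : nat)].
Definition cidx x : nat := index x (traject pi (cmax x) #|porbit pi x|).

Definition theta_before x y :=
  (cmax x < cmax y) || ((cmax x == cmax y) && (cidx x < cidx y)).

Lemma cmax_porbit x : cmax x \in porbit pi x.
Proof. by rewrite /cmax; case: arg_maxnP => //; exact: porbit_id. Qed.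

Lemma leq_cmax x y : y \in porbit pi x -> y <= cmax x.
Proof.
rewrite /cmax; case: arg_maxnP => [|i _ ub /ub //]; exact: porbit_id.
Qed.

Lemma porbit_cmax x : porbit pi (cmax x) = porbit pi x.
Proof. by apply/eqP; rewrite eq_porbit_mem cmax_porbit. Qed.

Lemma cycle_max_cmax x : cycle_max pi (cmax x).
Proof. by apply/forall_inP => y; rewrite porbit_cmax; exact: leq_cmax. Qed.

Lemma cmax_eq x m : m \in porbit pi x -> cycle_max pi m -> cmax x = m.
Proof.
move=> mx /forall_inP mm; apply/val_inj/eqP; rewrite eqn_leq leq_cmax // andbT.
apply: mm.
have /eqP -> : porbit pi m == porbit pi x by rewrite eq_porbit_mem.
exact: cmax_porbit.
Qed.

Lemma cmax_cycle_max m : cycle_max pi m -> cmax m = m.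
Proof. by apply: cmax_eq; exact: porbit_id. Qed.

Lemma eq_cmax x y : (cmax x == cmax y) = (porbit pi x == porbit pi y).
Proof.
apply/eqP/eqP => [eq_c | eq_p]; first by rewrite -porbit_cmax eq_c porbit_cmax.
by apply: cmax_eq; rewrite ?cycle_max_cmax // eq_p cmax_porbit.
Qed.

Lemma porbit_iter k x : porbit pi (iter k pi x) = porbit pi x.
Proof. by apply/eqP; rewrite eq_porbit_mem -permX mem_porbit. Qed.

Lemma cmax_iter k x : cmax (iter k pi x) = cmax x.
Proof. by apply/eqP; rewrite eq_cmax porbit_iter. Qed.

Lemma cidx_lt x : cidx x < #|porbit pi x|.
Proof.
rewrite -[X in _ < X](size_traject pi (cmax x)) index_mem.
by rewrite -[X in traject _ _ #|pred_of_set X|]porbit_cmax -porbit_traject porbit_cmax porbit_id.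
Qed.

Lemma iter_cidx x : iter (cidx x) pi (cmax x) = x.
Proof.
rewrite -(nth_traject pi (cidx_lt x)) nth_index //.
by rewrite -index_mem size_traject; exact: cidx_lt.
Qed.

Lemma cidx_iter x k : k < #|porbit pi x| -> cidx (iter k pi (cmax x)) = k.
Proof.
move=> lt_k; rewrite /cidx cmax_iter porbit_iter.
rewrite -porbit_cmax (cmax_cycle_max (cycle_max_cmax x)).
rewrite -porbit_cmax in lt_k.
rewrite -(nth_traject pi lt_k) index_uniq ?size_traject //.
exact: uniq_traject_porbit.
Qed.

Lemma cidx_cycle_max m : cycle_max pi m -> cidx m = 0.
Proof.
move=> /cmax_cycle_max mm; rewrite -{1}mm (@cidx_iter m 0) //.
by apply: leq_ltn_trans (cidx_lt m).
Qed.

Lemma cidx_gt0 x : ~~ cycle_max pi x -> 0 < cidx x.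
Proof.
apply: contraR; rewrite -eqn0Ngt => /eqP c0.
by rewrite -(iter_cidx x) c0 /= cycle_max_cmax.
Qed.

Lemma cidx_perm x : ~~ cycle_max pi (pi x) -> cidx (pi x) = (cidx x).+1.
Proof.
move=> nmax; have ex : pi x = iter (cidx x).+1 pi (cmax x) by rewrite /= iter_cidx.
have := cidx_lt x; rewrite leq_eqVlt => /predU1P[eq_k | lt_k]; last first.
  by rewrite ex cidx_iter.
case/negP: nmax; rewrite ex eq_k -porbit_cmax iter_porbit; exact: cycle_max_cmax.
Qed.

Lemma cmax_perm x : cmax (pi x) = cmax x. Proof. exact: (cmax_iter 1). Qed.

Lemma theta_before_trans : transitive theta_before.
Proof.
move=> y x z; rewrite /theta_before -!val_eqE /=; lia.
Qed.

Lemma theta_before_total x y : x != y -> theta_before x y || theta_before y x.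
Proof.
move=> ne; rewrite /theta_before -!val_eqE /=.
suff : (cmax x == cmax y) && (cidx x == cidx y) = false by rewrite -!val_eqE /=; lia.
apply/negbTE; apply: contraNN ne => /andP[/eqP ec /eqP ei].
by rewrite -(iter_cidx x) -(iter_cidx y) ec ei.
Qed.

Lemma theta_before_cmax x : ~~ cycle_max pi x -> theta_before (cmax x) x.
Proof.
move=> /cidx_gt0 gt0; rewrite /theta_before cidx_cycle_max ?cycle_max_cmax //.
by rewrite (cmax_cycle_max (cycle_max_cmax x)) eqxx gt0 orbT.
Qed.

Lemma theta_before_perm x : ~~ cycle_max pi (pi x) -> theta_before x (pi x).
Proof.
by move=> nmax; rewrite /theta_before cmax_perm eqxx cidx_perm // ltnSn orbT.
Qed.

(** Unless [pi x] opens a cycle, [x] and [pi x] are neighbours in the word, so no third letter fits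
    between them. *)
Lemma theta_before_adjacent x y : ~~ cycle_max pi (pi x) ->
  y != x -> y != pi x -> theta_before y x || theta_before (pi x) y.
Proof.
move=> nmax nx npx.
have := theta_before_total nx; have := theta_before_total npx.
rewrite /theta_before cmax_perm cidx_perm // -!val_eqE /=; lia.
Qed.

(** Cycle maxima are left-to-right maxima of [theta pi]: as [m] has index 0, every earlier letter
    lies in a cycle with a smaller maximum. *)
Lemma theta_before_cycle_max x m : cycle_max pi m -> theta_before x m -> x < m.
Proof.
move=> mm; rewrite /theta_before (cmax_cycle_max mm) (cidx_cycle_max mm) ltn0.
rewrite andbF orbF; apply: leq_ltn_trans; apply: leq_cmax; exact: porbit_id.
Qed.

Lemma sorted_theta_word : sorted theta_before (theta_word pi).
Proof.
rewrite /theta_word /standard_cycles; apply: pairwise_sorted.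
set ms := filter _ _.
have ms_max : all (cycle_max pi) ms by exact: filter_all.
have : sorted (fun x y => x < y) ms.
  apply: sorted_filter; first by move=> ? ? ?; exact: ltn_trans.
  have := iota_ltn_sorted 0 n; rewrite -val_enum_ord sorted_map.
  exact: sub_sorted.
rewrite sorted_pairwise; last by move=> ? ? ?; exact: ltn_trans.
have in_traj m x : cycle_max pi m -> x \in traject pi m #|porbit pi m| -> cmax x = m.
  move=> mm; rewrite -porbit_traject -eq_porbit_mem => /eqP eq_p.
  by apply: cmax_eq; rewrite // eq_p porbit_id.
elim: ms ms_max => //= m ms IH /andP[mm ms_max] /andP[m_lt ms_lt].
rewrite pairwise_cat IH // andbT; apply/andP; split.
  apply/allrelP => x y xm /flattenP[_ /mapP[m' m's ->] ym'].
  rewrite /theta_before (in_traj m) // (in_traj m') ?(allP m_lt) //.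
  exact: (allP ms_max).
apply/(pairwiseP m) => i j; rewrite !inE size_traject => lt_i lt_j ij.
rewrite !nth_traject // /theta_before !cmax_iter eqxx /=.
by rewrite -(cmax_cycle_max mm) !cidx_iter ?ij ?orbT.
Qed.

Lemma index_theta (i : 'I_n) : index (theta pi i) (theta_word pi) = i.
Proof.
by rewrite permE /theta_fun index_uniq ?size_theta_word ?uniq_theta_word.
Qed.

Lemma mem_theta_word x : x \in theta_word pi.
Proof. by rewrite (perm_mem (perm_theta_word pi)) mem_enum. Qed.

Lemma theta_before_theta (i j : 'I_n) :
  theta_before (theta pi i) (theta pi j) = (i < j).
Proof.
have imp (k l : 'I_n) : k < l -> theta_before (theta pi k) (theta pi l).
  move=> kl; apply: (sorted_ltn_index theta_before_trans sorted_theta_word);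
  by rewrite ?mem_theta_word ?index_theta.
case: (ltngtP i j) => [/imp -> // | /imp ji | /val_inj ->].
  by move: ji; rewrite /theta_before -!val_eqE /=; lia.
by rewrite /theta_before; lia.
Qed.

(** Phrased with letters instead of positions, so that the one-line notation of [theta pi] need not
    be handled again. *)
Lemma avoids321_thetaP :
  reflect (forall x y z, theta_before x y -> theta_before y z ->
             z < y -> y < x -> False)
          (avoids pat321 (theta pi)).
Proof.
apply: (iffP (avoids321P _)) => av i j k.
  rewrite -[i](permKV (theta pi)) -[j](permKV (theta pi)) -[k](permKV (theta pi)).
  by rewrite !theta_before_theta; exact: av.
by rewrite -(theta_before_theta i j) -(theta_before_theta j k); exact: av.
Qed.

End CycleOrder.

(** * The counted permutations, characterised without [theta] *)

(** The second condition makes each cycle ascend after its maximum. The third will keep the letters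
    L of the Motzkin word at height 1. *)
Definition good_perm n (pi : 'S_n) : Prop :=
  [/\ avoids pat321 pi,
      forall p : 'I_n, pi p < p -> cycle_max pi p
    & forall c b : 'I_n, c < b -> b < pi c -> pi c < pi b ->
        pi c < pi (pi c) -> False].

Section GoodPermutations.
Variables (n : nat) (pi : 'S_n).
Implicit Types x y z m c b p : 'I_n.

Lemma exc_not_cycle_max x : x < pi x -> ~~ cycle_max pi x.
Proof.
move=> lt_x; apply/negP => /forall_inP/(_ (pi x)); rewrite (mem_porbit pi 1).
by move=> /(_ isT); rewrite leqNgt lt_x.
Qed.

Lemma desc_perm_not_cycle_max p : pi p < p -> ~~ cycle_max pi (pi p).
Proof.
move=> lt_p; apply/negP => /forall_inP/(_ p).
have -> : p \in porbit pi (pi p) by rewrite porbit_sym (mem_porbit pi 1).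
by move=> /(_ isT); rewrite leqNgt lt_p.
Qed.

Lemma fixed_cycle_max x : pi x = x -> cycle_max pi x.
Proof.
by move=> fx; apply/forall_inP => y /porbitP[k ->]; rewrite permX iter_fix.
Qed.

Lemma avoids321_theta_good :
  avoids pat321 pi -> avoids pat321 (theta pi) -> good_perm pi.
Proof.
move=> av /avoids321_thetaP avt; split=> // [p lt_p | c b cb bc cpb cc].
  (* Otherwise the maximum of the cycle, [p] and [pi p] would form a 321 in [theta pi]. *)
  apply: contraT => nmax.
  have npx := desc_perm_not_cycle_max lt_p.
  case: (avt (cmax pi p) p (pi p)) => //.
  - exact: theta_before_cmax.
  - exact: theta_before_perm.
  rewrite ltn_neqAle leq_cmax ?porbit_id // andbT; apply: contraNneq nmax.
  by move=> /val_inj ->; exact: cycle_max_cmax.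
have nb : ~~ cycle_max pi b by apply: exc_not_cycle_max; lia.
have nc : ~~ cycle_max pi (pi c) by exact: exc_not_cycle_max.
have lt_cmax x : ~~ cycle_max pi x -> x < cmax pi x.
  move=> nx; rewrite ltn_neqAle leq_cmax ?porbit_id // andbT.
  by apply: contraNneq nx => /val_inj ->; exact: cycle_max_cmax.
have ne_bc : b != c by rewrite -val_eqE /=; lia.
have ne_bpc : b != pi c by rewrite -val_eqE /=; lia.
(* The letter [b] comes before [c] or after [pi c]. A 321 is then formed by [b], [c], or by [pi c],
   [b], preceded by the maximum of the cycle of its middle letter. *)
have /orP[bef|aft] := theta_before_adjacent nc ne_bc ne_bpc.
- exact: (avt _ _ _ (theta_before_cmax nb) bef cb (lt_cmax _ nb)).
- exact: (avt _ _ _ (theta_before_cmax nc) aft bc (lt_cmax _ nc)).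
Qed.

Hypothesis good : good_perm pi.

Lemma good_ascent x : ~~ cycle_max pi x -> x < pi x.
Proof.
move=> nmax; case: (ltngtP x (pi x)) => // [lt_p | /val_inj/esym fx].
  by case: good => _ /(_ x lt_p); rewrite (negbTE nmax).
by rewrite fixed_cycle_max in nmax.
Qed.

Lemma not_cycle_max_iter x k : 0 < k < #|porbit pi x| ->
  ~~ cycle_max pi (iter k pi (cmax pi x)).
Proof.
by case/andP=> gt0 lt_k; apply: contraTN gt0 => /cidx_cycle_max;
  rewrite cidx_iter // => ->.
Qed.

Lemma good_cycle_incr x j k : 0 < j -> j <= k -> k < #|porbit pi x| ->
  iter j pi (cmax pi x) <= iter k pi (cmax pi x).
Proof.
move=> gt0; elim: k => [|k IH]; first by lia.
rewrite leq_eqVlt => /predU1P[-> // | lt_j] lt_k.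
have le_jk := IH lt_j (ltnW lt_k).
apply: leq_trans le_jk _; apply: ltnW; apply: good_ascent.
by apply: not_cycle_max_iter; lia.
Qed.

Lemma good_avoids321_theta : avoids pat321 (theta pi).
Proof.
case: (good) => av peak level.
apply/avoids321_thetaP => x y z xy yz lt_zy lt_yx.
have ny : ~~ cycle_max pi y.
  by apply/negP => my; have := theta_before_cycle_max my xy; lia.
have nz : ~~ cycle_max pi z.
  by apply/negP => mz; have := theta_before_cycle_max mz yz; lia.
have y_asc := good_ascent ny.
move: yz; rewrite /theta_before => /orP[lt_m | /andP[/eqP eq_m lt_i]].
  (* With [y] and [z] in different cycles, follow the cycle of [z] from [z < y] to its first step
     [e < y < pi e], and compare [e] with the preimage [c] of [y]. *)
  have ne_orb k : iter k pi z != y.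
    apply: contraTneq lt_m => <-; rewrite cmax_iter; lia.
  have [k lt_k min_k] : exists2 k, y < iter k pi z &
      forall j, y < iter j pi z -> k <= j.
    have ex_k : exists k, y < iter k pi z.
      have : cmax pi z \in porbit pi z by exact: cmax_porbit.
      case/porbitP => k def_m; exists k; rewrite -permX -def_m.
      by apply: leq_ltn_trans lt_m; apply: leq_cmax; exact: porbit_id.
    by case: (ex_minnP ex_k) => k; exists k.
  case: k lt_k min_k => [|k] lt_k min_k; first by move: lt_k => /=; lia.
  set e := iter k pi z in lt_k.
  have lt_e : e < y.
    have : e != y :> nat by rewrite val_eqE; exact: ne_orb.
    by have := min_k k; rewrite -/e; lia.
  rewrite iterS -/e in lt_k.
  set c := (pi^-1)%g y; have def_y : y = pi c by rewrite permKV.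
  have [lt_cy | le_yc] := ltnP c y.
    have [lt_ce | lt_ec | /val_inj eq_ec] := ltngtP c e.
    - by apply: (level c e); rewrite -?def_y.
    - have := avoids321_exc_mono av lt_ec; rewrite -def_y; lia.
    - by move: lt_k; rewrite -eq_ec -def_y ltnn.
  (* Here [c] is the maximum of the cycle of [y], smaller than that of [z]. Monotonicity at the
     non-excedance [c] puts [y] below the second letter of the cycle of [z], hence below [z]. *)
  have lt_yc : pi c < c.
    rewrite -def_y ltn_neqAle le_yc andbT; apply: contraTneq y_asc => /val_inj eq_y.
    by rewrite {2}eq_y -def_y ltnn.
  have cm : cmax pi y = c.
    by rewrite def_y cmax_perm cmax_cycle_max // peak.
  have gt0 := cidx_gt0 nz.
  have : iter 1 pi (cmax pi z) <= iter (cidx pi z) pi (cmax pi z).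
    by apply: good_cycle_incr => //; exact: cidx_lt.
  rewrite iter_cidx /= => le_z.
  rewrite cm in lt_m.
  have := avoids321_nonexc_mono av lt_m (ltnW lt_yc).
  by rewrite -def_y; lia.
have : iter (cidx pi y) pi (cmax pi y) <= iter (cidx pi z) pi (cmax pi z).
  rewrite eq_m; apply: good_cycle_incr; rewrite ?cidx_gt0 ?cidx_lt //.
  exact: ltnW.
by rewrite !iter_cidx leqNgt lt_zy.
Qed.

End GoodPermutations.

Lemma avoids321_goodP n (pi : 'S_n) :
  reflect (good_perm pi) (avoids pat321 pi && avoids pat321 (theta pi)).
Proof.
apply: (iffP andP) => [[av avt] | good]; first exact: avoids321_theta_good.
by split; [case: good | exact: good_avoids321_theta].
Qed.

(** * Permutations as labelled Motzkin paths *)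

(* The letters are U = (true, false), L = (true, true), D = (false, true) and
   F = (false, false). *)
Fixpoint motzkin_word h (w : seq (bool * bool)) : bool :=
  match w with
  | [::] => h == 0
  | (true, false) :: w' => motzkin_word h.+1 w'
  | (true, true) :: w' => (h == 1) && motzkin_word h w'
  | (false, true) :: w' => (0 < h) && motzkin_word h.-1 w'
  | (false, false) :: w' => (h == 0) && motzkin_word h w'
  end.

Local Notation letter w i := (nth (false, false) w i).

(** With a letter coded by bits [(e, v)], the step is [e - v], and a level step is allowed exactly
    at the height given by its common bit. [H i] is the height before letter [i]. *)
Lemma motzkin_wordP h w :
  reflect (exists H : nat -> nat,
    [/\ H 0 = h, H (size w) = 0
      & forall i, i < size w ->
          H i + (letter w i).1 = H i.+1 + (letter w i).2 /\
          ((letter w i).1 = (letter w i).2 -> H i = (letter w i).1)])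
    (motzkin_word h w).
Proof.
apply: (iffP idP).
  elim: w h => [|[e v] w IH] h; first by move/eqP=> ->; exists (fun=> 0).
  move=> /= mot.
  have [h' mot' [st lev]] : exists2 h', motzkin_word h' w &
      h + e = h' + v /\ (e = v -> h = e).
    case: e v mot => -[].
    - by case/andP=> /eqP -> mot; exists 1.
    - by move=> mot; exists h.+1 => //; split=> //; lia.
    - by case/andP=> gt0 mot; exists h.-1 => //; split=> //; lia.
    - by case/andP=> /eqP -> mot; exists 0.
  have [H [H0 Hn HS]] := IH _ mot'.
  exists (fun i => if i is j.+1 then H j else h); split=> // -[_|i lt_i] /=.
    by rewrite H0.
  exact: HS.
elim: w h => [|[e v] w IH] h [H [H0 Hn HS]] /=; first by rewrite -H0 Hn.
have mot : motzkin_word (H 1) w.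
  by apply: IH; exists (H \o succn); split=> // i lt_i; exact: (HS i.+1).
have [/= st lev] := HS 0 isT; rewrite H0 in st lev.
case: e v st lev {HS Hn} => -[] /= st lev.
- by rewrite {1}lev //= (_ : h = H 1) //; have := lev erefl; lia.
- by rewrite (_ : h.+1 = H 1) //; lia.
- by rewrite (_ : h.-1 = H 1) ?mot; lia.
- by rewrite {1}lev //= (_ : h = H 1) //; have := lev erefl; lia.
Qed.

(** A position with [pi i < i < pi^-1 i] would also read as F. In a good permutation it does not
    occur: [i] would be a cycle maximum below its own preimage. *)
Definition perm_word n (pi : 'S_n) : n.-tuple (bool * bool) :=
  [tuple (i < pi i, (pi^-1)%g i < i) | i < n].

Lemma letter_perm_word n (pi : 'S_n) (i : 'I_n) :
  letter (perm_word pi) i = (i < pi i, (pi^-1)%g i < i).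
Proof. by rewrite -tnth_nth tnth_mktuple. Qed.

(** At the first disagreement [i], say [a i < b i], the value [a i] is taken by [b] at a later [j].
    Equal words make [j] an excedance of [b] when [i] is one, and monotonicity gives
    [b i < b j = a i]. *)
Lemma perm_word_inj n (pi rho : 'S_n) : good_perm pi -> good_perm rho ->
  perm_word pi = perm_word rho -> pi = rho.
Proof.
move=> gpi grho eq_w.
have step (a b : 'S_n) : good_perm a -> good_perm b ->
    perm_word a = perm_word b -> forall i : 'I_n,
    (forall j : 'I_n, j < i -> a j = b j) -> a i < b i -> False.
  move=> ga gb eq_ab i IH lt_ab.
  set j := (b^-1)%g (a i); have def_j : b j = a i by rewrite permKV.
  have lt_ij : i < j.
    case: (ltngtP i j) => // [lt_ji | /val_inj eq_ij].
      have := IH _ lt_ji; rewrite def_j => /perm_inj eq_ji.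
      by move: lt_ji; rewrite eq_ji ltnn.
    by move: lt_ab; rewrite -def_j -eq_ij ltnn.
  have := letter_perm_word a i; rewrite eq_ab letter_perm_word => -[eE _].
  have := letter_perm_word a (a i); rewrite eq_ab letter_perm_word permK => -[_ eV].
  rewrite -/j in eV; case: gb => av _ _.
  have [lt_i | le_i] := ltnP i (b i).
    have lt_j : j < b j by rewrite def_j; lia.
    by have := avoids321_exc_mono av lt_ij lt_j; rewrite def_j; lia.
  by have := avoids321_nonexc_mono av lt_ij le_i; rewrite def_j; lia.
apply/permP => i; move: {2}i.+1 (ltnSn i) => k.
elim: k i => // k IH i lt_i.
have IH' (j : 'I_n) : j < i -> pi j = rho j by move=> lt_j; apply: IH; lia.
apply/val_inj; case: (ltngtP (pi i) (rho i)) => // [/(step pi rho)|/(step rho pi)] [] //.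
by move=> j /IH'.
Qed.

Lemma sum_indicator1 (T : finType) (P : pred T) (x : T) :
  \sum_y ((y == x) && P y) = P x :> nat.
Proof.
rewrite (bigD1 x) //= eqxx /= big1 ?addn0 // => y /negbTE ->.
by [].
Qed.

Lemma good_perm_word_motzkin n (pi : 'S_n) :
  good_perm pi -> motzkin_word 0 (perm_word pi).
Proof.
case=> av peak level; apply/motzkin_wordP.
pose H i := \sum_(j < n) ((j < i) && (i <= pi j)).
have H_eq0 i : (forall j : 'I_n, j < i -> i <= pi j -> False) -> H i = 0.
  move=> no; rewrite /H big1 // => j _; case: ltnP => //= lt_j.
  by case: leqP => //= /(no j lt_j).
exists H; rewrite size_tuple; split.
- by rewrite /H big1.
- by apply: H_eq0 => j _; rewrite leqNgt ltn_ord.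
move=> k lt_k; rewrite -[k]/(nat_of_ord (Ordinal lt_k)).
move: (Ordinal lt_k) => i {k lt_k}; rewrite letter_perm_word /=.
set c := (pi^-1)%g i; have def_i : pi c = i by rewrite permKV.
have fixE : (pi i == i :> nat) = (c == i :> nat).
  by rewrite !val_eqE -{2}def_i (inj_eq perm_inj) eq_sym.
(* Both sides count the [j <= i] with [pi j >= i]: [j = i] enters on the left, and [j = c], whose
   value is [i], is restored on the right. *)
have stepH : H i + (i <= pi i) = H i.+1 + (c <= i).
  rewrite -(sum_indicator1 (fun j : 'I_n => i <= pi j)).
  rewrite -(sum_indicator1 (fun j : 'I_n => j <= i)) /H -!big_split /=.
  apply: eq_bigr => j _.
  have -> : (j == c) = (pi j == i :> nat).
    by rewrite val_eqE -def_i (inj_eq perm_inj).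
  by rewrite -val_eqE /=; lia.
split; first by lia.
case: (ltnP i (pi i)) => /= lt_i; case: (ltnP c i) => //= lt_c _; last first.
  have fix_i : pi i = i.
    apply/val_inj/eqP; apply: contraT => ne.
    have lt_pi : pi i < i by rewrite ltn_neqAle ne lt_i.
    have /forall_inP/(_ c) := peak _ lt_pi.
    have -> : c \in porbit pi i by rewrite porbit_sym -def_i (mem_porbit pi 1).
    move=> /(_ isT) le_c; move: ne; rewrite fixE; lia.
  apply: H_eq0 => j lt_ji le_ij.
  have := avoids321_nonexc_mono av; have [l le_il lt_li] := crossing_down lt_ji le_ij.
  have ne_l : i != l :> nat by apply/eqP => /val_inj eq_l; move: lt_li; rewrite -eq_l fix_i ltnn.
  have lt_il : i < l by lia.
  by move=> /(_ _ _ lt_il); rewrite fix_i leqnn => /(_ isT); lia.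
(* At an L only the arc from [c] counts: another one starting before [c] breaks monotonicity, and
   one starting after [c] breaks the third condition. *)
rewrite /H (bigD1 c) //= lt_c def_i leqnn big1 ?addn0 // => j ne_j.
have ne_pj : pi j != i :> nat by rewrite val_eqE -def_i (inj_eq perm_inj).
case: (ltnP j i) => //= lt_j; case: leqP => //= le_i.
have [lt_jc | lt_cj | /val_inj eq_jc] := ltngtP j c; last by rewrite eq_jc eqxx in ne_j.
  have := avoids321_exc_mono av lt_jc; rewrite def_i; lia.
by case: (level c j); rewrite ?def_i //; lia.
Qed.

(** * Ranks of positions within a class of letters *)

Definition count_below (f : pred nat) i := count f (iota 0 i).

Section CountBelow.
Implicit Types (f g h : pred nat) (i j k : nat).

Lemma count_belowS f i : count_below f i.+1 = count_below f i + f i.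
Proof. by rewrite /count_below -addn1 iotaD count_cat /= addn0. Qed.

Lemma count_below_leq f i j : i <= j -> count_below f i <= count_below f j.
Proof.
move=> /subnK <-; elim: (j - i) => // k IH.
by rewrite addSn count_belowS; apply: leq_trans IH (leq_addr _ _).
Qed.

Lemma count_below_ltn f i j : f i -> i < j -> count_below f i < count_below f j.
Proof.
by move=> fi /(count_below_leq f); rewrite count_belowS fi addn1.
Qed.

Lemma count_below_inj f i j :
  f i -> f j -> count_below f i = count_below f j -> i = j.
Proof.
by move=> fi fj eq_c; case: (ltngtP i j) => // [/(count_below_ltn fi) | /(count_below_ltn fj)];
  rewrite eq_c ltnn.
Qed.

Lemma count_below_const f i j : i <= j ->
  (forall k, i <= k -> k < j -> ~~ f k) -> count_below f j = count_below f i.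
Proof.
move=> /subnK <-; elim: (j - i) => // d IH no.
rewrite addSn count_belowS (negbTE (no _ _ _)) ?leq_addl ?addn0 //.
by apply: IH => k ik kd; apply: no => //; lia.
Qed.

Lemma count_below_onto f n k : k < count_below f n ->
  exists2 v, v < n & f v /\ count_below f v = k.
Proof.
elim: n => // n IH; rewrite count_belowS => lt_k.
have [/IH[v lt_v def_k] | le_k] := ltnP k (count_below f n).
  by exists v => //; exact: ltnW.
by exists n => //; case: (f n) lt_k; split=> //; lia.
Qed.

Lemma count_below_add f g h i : (forall j, f j = g j + h j :> nat) ->
  count_below f i = count_below g i + count_below h i.
Proof. by move=> eq_f; elim: i => // i IH; rewrite !count_belowS IH eq_f; lia. Qed.

End CountBelow.

Lemma motzkin_word_perm n (w : n.-tuple (bool * bool)) : motzkin_word 0 w ->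
  exists2 pi : 'S_n, good_perm pi & perm_word pi = w.
Proof.
move=> /motzkin_wordP[H []]; rewrite size_tuple => H0 Hn HS.
pose E i := (letter w i).1; pose V i := (letter w i).2.
pose NE i := ~~ E i; pose NV i := ~~ V i.
pose U i := E i && ~~ V i; pose L i := E i && V i.
pose D i := ~~ E i && V i; pose F i := ~~ E i && ~~ V i.
have UE i : U i = E i && ~~ V i by [].
have LE i : L i = E i && V i by [].
have FE i : F i = ~~ E i && ~~ V i by [].
have cE i : count_below E i = count_below U i + count_below L i.
  by apply: count_below_add => j; rewrite /U /L; case: (E j); case: (V j).
have cV i : count_below V i = count_below D i + count_below L i.
  by apply: count_below_add => j; rewrite /D /L; case: (E j); case: (V j).
have cNE i : count_below NE i = count_below D i + count_below F i.
  by apply: count_below_add => j; rewrite /NE /D /F; case: (E j); case: (V j).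
have cNV i : count_below NV i = count_below U i + count_below F i.
  by apply: count_below_add => j; rewrite /NV /U /F; case: (E j); case: (V j).
have level i : i < n -> E i = V i -> H i = E i by move=> /HS[].
have height i : i <= n -> H i + count_below D i = count_below U i.
  elim: i => [|i IH] lt_i; first by rewrite H0.
  have [st _] := HS i lt_i; have := IH (ltnW lt_i).
  by rewrite !count_belowS /U /D; move: st; rewrite -/(E i) -/(V i); case: (E i); case: (V i); lia.
(* Positions are matched with values of equal rank, [E] with [V] and [NE] with [NV]. The classes
   have equal sizes because the path ends at height 0. *)
have ex (i : 'I_n) : exists v : 'I_n, V v = E i /\
    if E i then count_below E i = count_below V v
    else count_below NE i = count_below NV v.
  have hn := height n (leqnn n); rewrite Hn in hn.
  case Ei: (E i).
    have : count_below E i < count_below V n.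
      have := count_below_ltn Ei (ltn_ord i); rewrite cV; have := cE n; lia.
    by case/count_below_onto => v lt_v [Vv <-]; exists (Ordinal lt_v).
  have : count_below NE i < count_below NV n.
    have := @count_below_ltn NE i n; rewrite {1}/NE Ei => /(_ isT (ltn_ord i)).
    by rewrite cNV; have := cNE n; lia.
  by case/count_below_onto => v lt_v [Vv <-]; exists (Ordinal lt_v); split=> //;
    apply: negbTE.
have [f fP] := fin_all_exists ex.
have Vf i : V (f i) = E i by case: (fP i).
have fE (i : 'I_n) : E i -> count_below E i = count_below V (f i).
  by move=> Ei; case: (fP i); rewrite Ei.
have fNE (i : 'I_n) : ~~ E i -> count_below NE i = count_below NV (f i).
  by move=> Ei; case: (fP i); rewrite (negbTE Ei).
have incr (i j : 'I_n) : i < j -> E i = E j -> f i < f j.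
  move=> lt_ij eq_E; rewrite ltnNge; apply/negP => le_f.
  case Ei: (E i).
    have := count_below_leq V le_f; rewrite -!fE -?eq_E //.
    by have := count_below_ltn Ei lt_ij; lia.
  have := count_below_leq NV le_f; rewrite -!fNE -?eq_E ?Ei //.
  by have := @count_below_ltn NE i j; rewrite {1}/NE Ei => /(_ isT lt_ij); lia.
have inj_f : injective f.
  move=> i j eq_f; have eq_E : E i = E j by rewrite -!Vf eq_f.
  apply/val_inj; case: (ltngtP i j) => // [/incr/(_ eq_E) | /incr/(_ (esym eq_E))];
  by rewrite eq_f ltnn.
(* If [f i <= i], equality of ranks forces height 0 and [V i], but then [i] is an L, which has
   height 1. *)
have exc (i : 'I_n) : E i -> i < f i.
  move=> Ei; rewrite ltnNge; apply/negP => le_f.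
  have Vfi : V (f i) by rewrite Vf.
  have := count_below_ltn Vfi (le_f : f i < i.+1); rewrite -fE // count_belowS.
  rewrite cE cV; have := height i (ltnW (ltn_ord i)); have := level i (ltn_ord i).
  by rewrite Ei; case: (V i) => /=; [move=> /(_ erefl) |]; lia.
have nexc (i : 'I_n) : ~~ E i -> f i <= i.
  move=> Ei; rewrite leqNgt; apply/negP => lt_f.
  have := count_below_leq NV lt_f; rewrite -fNE // count_belowS.
  rewrite cNE cNV; have := height i (ltnW (ltn_ord i)); have [] := HS i (ltn_ord i).
  rewrite -/(E i) -/(V i) (negbTE Ei) /NV; case: (V i) => /=; lia.
have excE (i : 'I_n) : E i = (i < f i).
  by case Ei: (E i); [rewrite exc | have := @nexc i; rewrite Ei => /(_ isT); lia].
have fixF (i : 'I_n) : F i -> f i = i.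
  case/andP=> Ei Vi; apply/val_inj/(@count_below_inj NV) => //.
    by rewrite /NV Vf.
  rewrite -fNE // cNE cNV; have := height i (ltnW (ltn_ord i)).
  by have := level i (ltn_ord i); rewrite (negbTE Ei) (negbTE Vi) => /(_ erefl) /=; lia.
(* Ranks would give the L at [k] height at least 2. In the same way [noF] would have an F at
   positive height. *)
have noL (i : 'I_n) k : E i -> i < k -> k < f i -> ~~ L k.
  move=> Ei lt_ik lt_kf; apply/negP => /andP[Ek Vk].
  have lt_kn : k < n by apply: ltn_trans (ltn_ord (f i)).
  have := count_below_ltn Ei lt_ik; have := count_below_ltn Vk lt_kf.
  have := level k lt_kn; rewrite Ek Vk => /(_ erefl) /=.
  have := height k (ltnW lt_kn); have := cE k; have := cV k.
  by rewrite (fE i) //; lia.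
have noF (i : 'I_n) k : ~~ E i -> f i < k -> k < i -> ~~ F k.
  move=> Ei lt_fk lt_ki; apply/negP => /andP[Ek Vk].
  have lt_kn : k < n by apply: ltn_trans (ltn_ord i).
  have NVf : NV (f i) by rewrite /NV Vf.
  have := @count_below_ltn NE k i Ek lt_ki; have := count_below_ltn NVf lt_fk.
  have := level k lt_kn; rewrite (negbTE Ek) (negbTE Vk) => /(_ erefl) /=.
  have := height k (ltnW lt_kn); have := cNE k; have := cNV k.
  by rewrite (fNE i) //; lia.
pose pi := perm inj_f.
have piE i : pi i = f i by rewrite permE.
have pivE (i : 'I_n) : V i = ((pi^-1)%g i < i).
  by rewrite -{1 3}[i](permKV pi) piE Vf excE.
exists pi; last first.
  apply: eq_from_tnth => i; rewrite tnth_mktuple piE -excE -pivE /E /V.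
  by rewrite (tnth_nth (false, false)); case: nth.
(* The j-th U and the j-th D lie in the same cycle; [rank] is j on that cycle. *)
pose rank (i : 'I_n) := if U i then count_below U i else count_below D i.
have rank_f i : rank (f i) = rank i.
  case Fi: (F i); first by rewrite fixF.
  rewrite /rank !UE Vf; case Ei: (E i) => /=.
    rewrite andbF.
    have := height i (ltnW (ltn_ord i)); have := level i (ltn_ord i).
    have := fE i Ei; rewrite cE cV.
    (* By [noL] the L's cancel from the equality of ranks, which leaves U's against D's. For a
       letter D, [noF] cancels the F's below. *)
    have -> : count_below L (f i) = count_below L i.+1.
      by apply: count_below_const; rewrite ?exc // => k; exact: noL.
    by rewrite count_belowS LE Ei; case: (V i) => /=; [move=> + /(_ erefl) |]; lia.
  have Efi : E (f i).
    apply: contraT => NEf; have : F (f i) by rewrite /F NEf Vf Ei.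
    move/fixF/inj_f => eq_f; move: Fi; rewrite -eq_f /F NEf Vf Ei //.
  rewrite Efi /=; have := @fNE i; rewrite Ei cNE cNV => /(_ isT).
  have -> : count_below F i = count_below F (f i).+1.
    apply: count_below_const => [|k]; last by apply: noF; rewrite Ei.
    have := @nexc i; rewrite Ei => /(_ isT); rewrite leq_eqVlt => /predU1P[/val_inj eq_f|//].
    by move: Efi; rewrite eq_f Ei.
  by rewrite count_belowS FE Efi; lia.
have rank_orbit x y : y \in porbit pi x -> rank y = rank x.
  case/porbitP=> k ->; rewrite permX; elim: k => //= k <-.
  by rewrite piE rank_f.
have peakD (p : 'I_n) : pi p < p -> D p.
  rewrite piE /D => lt_p; have NEp : ~~ E p by rewrite excE; lia.
  rewrite NEp; apply: contraT => NVp; have : F p by rewrite /F NEp NVp.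
  by move/fixF => eq_p; move: lt_p; rewrite eq_p ltnn.
split.
(* Two of the three positions agree on [E], and [f] increases on each class. *)
- apply/avoids321P => i j k lt_ij lt_jk; rewrite !piE => lt_kj lt_ji.
  have := @incr i j lt_ij; have := @incr j k lt_jk; have := @incr i k (ltn_trans lt_ij lt_jk).
  by case: (E i); case: (E j); case: (E k) => h1 h2 h3;
    by [have := h1 erefl; lia | have := h2 erefl; lia | have := h3 erefl; lia].
(* Both [p] and the maximum of its cycle are D's of the same rank, hence equal. *)
- move=> p lt_p; have Dp := peakD p lt_p.
  have mp := cmax_porbit pi p; suff <- : cmax pi p = p by exact: cycle_max_cmax.
  have [// | ne_mp] := eqVneq (cmax pi p) p.
  have Dm : D (cmax pi p).
    apply: peakD; rewrite ltn_neqAle leq_cmax ?andbT; last first.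
      by rewrite -porbit_cmax (mem_porbit pi 1).
    apply: contraNneq ne_mp => /val_inj fix_m.
    by rewrite -[X in _ == X](iter_cidx pi) iter_fix.
  have := rank_orbit _ _ mp; rewrite /rank.
  case/andP: (Dp) => NEp _; case/andP: (Dm) => NEm _.
  by rewrite !UE (negbTE NEp) (negbTE NEm) /= => /(count_below_inj Dm Dp)/val_inj.
(* Such a [pi c] would be an L strictly between [b] and [pi b]. *)
move=> c b lt_cb lt_bc lt_cb' lt_cc.
rewrite !piE in lt_bc lt_cb' lt_cc.
have Ec : E c by rewrite excE; lia.
have Eb : E b by rewrite excE; lia.
have := noL b (f c) Eb lt_bc lt_cb'.
by rewrite /L Vf Ec excE lt_cc.
Qed.

(** * Generating functions *)

Definition motzkin_count n h : nat :=
  #|[set w : n.-tuple (bool * bool) | motzkin_word h w]|.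

Lemma tcount_motzkin n : tcount pat321 n = motzkin_count n 0.
Proof.
rewrite /tcount /motzkin_count -(card_in_imset (f := @perm_word n)); last first.
  by move=> pi rho; rewrite !inE => /avoids321_goodP gp /avoids321_goodP gr;
    exact: perm_word_inj.
apply: eq_card => w; rewrite inE; apply/imsetP/idP => [[pi] | /motzkin_word_perm].
  by rewrite inE => /avoids321_goodP gp ->; exact: good_perm_word_motzkin.
by case=> pi gp <-; exists pi => //; rewrite inE; apply/avoids321_goodP.
Qed.

Lemma sum_tuple_cons (T : finType) n (f : n.+1.-tuple T -> nat) :
  \sum_w f w = \sum_a \sum_(w : n.-tuple T) f (cons_tuple a w).
Proof.
rewrite pair_big /= (reindex (fun p : T * n.-tuple T => cons_tuple p.1 p.2)) //=.
exists (fun w : n.+1.-tuple T => (thead w, behead_tuple w)) => [[a w] _ | w _].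
  by congr (_, _); apply: val_inj.
by rewrite [RHS]tuple_eta; apply: val_inj.
Qed.

Lemma motzkin_countE n h :
  motzkin_count n h = \sum_(w : n.-tuple (bool * bool)) motzkin_word h w.
Proof. by rewrite /motzkin_count -sum1_card -big_mkcond /=; apply: eq_bigl => w; rewrite inE. Qed.

Lemma motzkin_count0 h : motzkin_count 0 h = (h == 0).
Proof.
rewrite motzkin_countE (eq_bigr (fun=> (h == 0) : nat)) => [|w _].
  by rewrite sum_nat_const card_tuple mul1n.
by rewrite tuple0.
Qed.

(** Split by the first letter. Heights 0 and 1 each admit one level step, F and L respectively,
    whence the factor [h <= 1]. *)
Lemma motzkin_countS n h : motzkin_count n.+1 h =
  motzkin_count n h.+1 + (h <= 1) * motzkin_count n h
  + (0 < h) * motzkin_count n h.-1.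
Proof.
rewrite motzkin_countE sum_tuple_cons.
transitivity (\sum_e \sum_v \sum_(w : n.-tuple _) motzkin_word h ((e, v) :: w)).
  by rewrite [RHS]pair_bigA; apply: eq_bigr => -[].
rewrite !big_bool /= !motzkin_countE.
case: h => [|[|h]] /=; rewrite ?sum_nat_const ?muln0 ?mul1n ?mul0n ?addn0 ?add0n //; lia.
Qed.

Local Open Scope ring_scope.

(** * Solving the recurrence with power series *)

Section GeneratingFunction.
Variable K : fieldType.
Hypothesis nz2 : 2 != 0 :> K.

Lemma coefs0M (f g : fps K) : coefs (f * g) 0 = coefs f 0 * coefs g 0.
Proof. by rewrite coefsM big_ord1. Qed.

Lemma coefsXM0 (f : fps K) : coefs (fpsX * f) 0 = 0.
Proof. by rewrite coefs0M mul0r. Qed.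

Lemma coefsXMS (f : fps K) n : coefs (fpsX * f) n.+1 = coefs f n.
Proof.
rewrite coefsM !big_ord_recl /= mul0r add0r mul1r subSS subn0 big1 ?addr0 // => i _.
by rewrite mul0r.
Qed.

Definition motzkin_fps h : fps K := Fps (fun n => (motzkin_count n h)%:R).

(** The factor [fpsX] makes each coefficient depend only on earlier ones, so the system has a single
    solution. *)
Lemma motzkin_fps_uniq (Q : nat -> fps K) :
  (forall h, Q h = (h == 0%N)%:R +
     fpsX * (Q h.+1 + (h <= 1)%:R * Q h + (0 < h)%:R * Q h.-1)) ->
  forall h, motzkin_fps h = Q h.
Proof.
move=> QE h; apply: fpsP => n; elim: n h => [|n IH] h.
  rewrite /= motzkin_count0 QE coefsD coefsXM0 addr0.
  by case: eqP.
rewrite /= motzkin_countS QE coefsD coefsXMS !coefsD.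
have cb (b : bool) (f : fps K) k : coefs (b%:R * f) k = b%:R * coefs f k.
  by case: b; rewrite ?mul1r ?mul0r.
rewrite !cb -!IH /= !natrD !natrM.
by case: eqP => _; rewrite add0r.
Qed.

Let X : fps K := fpsX.
Let S : fps K := fps_sqrt (1 - 4 * X ^+ 2).
(** The Catalan series in [X ^+ 2], usually written [(1 - S) / (2 * X ^+ 2)]. This form inverts only
    a series with nonzero constant term. *)
Let c : fps K := 2 * (1 + S)^-1.

Lemma coefs_nat m : coefs (m%:R : fps K) 0 = m%:R.
Proof. by elim: m => // m IH; rewrite !mulrS coefsD IH. Qed.

Lemma unit_fpsE (f : fps K) : (f \is a GRing.unit) = (coefs f 0 != 0).
Proof. by []. Qed.

Lemma unit_1Dsqrt : 1 + S \is a GRing.unit.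
Proof. by rewrite unit_fpsE coefsD coefs_sqrt0; exact: nz2. Qed.

Lemma sqrt_catalanE : S = 1 - 2 * X ^+ 2 * c.
Proof.
have u := unit_1Dsqrt.
have SS : S ^+ 2 = 1 - 4 * X ^+ 2.
  by apply: fps_sqrtK => //; rewrite coefsD coefsN expr2 mulrCA coefsXM0 subr0.
apply: (mulIr u); rewrite /c mulrBl mul1r -[_ * _ * (1 + S)]mulrA divrK //.
by transitivity (S + S ^+ 2); [ring | rewrite SS; ring].
Qed.

Lemma catalan_eq : c = 1 + X ^+ 2 * c ^+ 2.
Proof.
have u2 : (2 : fps K) \is a GRing.unit by rewrite unit_fpsE coefs_nat.
have u := unit_1Dsqrt.
have : c * (1 + S) = 2 by rewrite /c divrK.
rewrite sqrt_catalanE => e; apply: (mulrI u2).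
transitivity (c * (1 + (1 - 2 * X ^+ 2 * c)) + 2 * (X ^+ 2 * c ^+ 2)); first ring.
by rewrite e; ring.
Qed.

Lemma motzkin_fps_eq : motzkin_fps 0 * (1 - X - X * c) = 1 - X * c.
Proof.
pose den := 1 - X - X * c.
have u : den \is a GRing.unit.
  by rewrite unit_fpsE !coefsD !coefsN coefsXM0 /= !subr0 oner_eq0.
pose Q h := (if h == 0%N then 1 - X * c else (X * c) ^+ h) * den^-1.
rewrite (@motzkin_fps_uniq Q); first by rewrite /Q /= -/den divrK.
have ce := catalan_eq; have e1 : 1 = den * den^-1 by rewrite divrr.
rewrite /Q; case=> [|[|h]] /=; set d := den^-1 in e1 *.
(* At height 0 the constant 1 becomes [den * d]. At height 1 the level step cancels the [- X * c] of
   [Q 0]. All heights [h > 0] then reduce to the equation for [c]. *)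
- transitivity (den * d + X * (X * c * d + (1 - X * c) * d)).
    by rewrite /den; ring.
  by rewrite -e1 -/X; ring.
- transitivity (X * (1 + X ^+ 2 * c ^+ 2) * d); first by rewrite -ce expr1.
  by rewrite -/X; ring.
transitivity ((X * c) ^+ h.+1 * (X * (1 + X ^+ 2 * c ^+ 2)) * d).
  by rewrite -ce exprSr.
by rewrite -/X !exprS; ring.
Qed.

Lemma motzkin_fps_closed :
  (motzkin_fps 0 - 1) * (2 * X * (1 - X) - 1 + S) = 2 * X ^+ 2.
Proof.
have -> : 2 * X * (1 - X) - 1 + S = 2 * X * (1 - X - X * c).
  by rewrite sqrt_catalanE; ring.
transitivity (2 * X * (motzkin_fps 0 * (1 - X - X * c) - (1 - X - X * c))); first ring.
by rewrite motzkin_fps_eq; ring.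
Qed.

End GeneratingFunction.

Theorem theorem3p10 :
  (Fps (fun n => if (1 <= n)%N then (tcount pat321 n)%:R else 0) : fps rat)%:F =
  (2 * fpsX ^+ 2)%:F /
  (2 * fpsX * (1 - fpsX) - 1 + fps_sqrt (1 - 4 * fpsX ^+ 2))%:F
  :> {fraction (fps rat)}.
Proof.
have nz2 : 2 != 0 :> rat by [].
(* Subtracting 1 removes the empty word, as the sum starts at [n = 1]. *)
have -> : (Fps (fun n => if (1 <= n)%N then (tcount pat321 n)%:R else 0) : fps rat)
    = motzkin_fps rat 0 - 1.
  apply: fpsP => -[|n]; rewrite coefsD coefsN /= ?motzkin_count0 ?subrr //.
  by rewrite tcount_motzkin subr0.
rewrite -(motzkin_fps_closed nz2) tofracM mulfK //.
(* The denominator has constant term 0, so only its being nonzero can be used. Were it zero, so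
   would be [2 * fpsX ^+ 2], whose coefficient of degree 2 is 2. *)
rewrite tofrac_eq0; apply/eqP => den0; have := motzkin_fps_closed nz2.
rewrite den0 mulr0 (_ : 2 * fpsX ^+ 2 = fpsX * (fpsX * 2)); last by ring.
by move=> /(congr1 (fun f => coefs f 2)); rewrite !coefsXMS coefs_nat.
Qed.
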